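(* Let $k\geq 2$ and $l>3$ be two natural numbers such that $k$ is even and $3\mid l$. Then $n(k,l)=\frac{2}{3}kl+1$.
   Context: $S_n$ and $A_n$ denote the symmetric and alternating groups on $n$ letters. For natural numbers $k,l\geq 2$ such that $l$ is odd or $k$ is even, $n(k,l)$ denotes the largest natural number $n$ such that every element of $A_n$ can be written as a product of $k$ (not necessarily distinct) $l$-cycles of $S_n$; equivalently, the largest $n$ such that $C_l^k=A_n$, where $C_l$ is the set of all $l$-cycles in $S_n$ and $C_l^k=\{x_1x_2\cdots x_k \mid x_i\in C_l\}$. *)

(* Defs.v *)
From mathcomp Require Import all_boot all_fingroup all_solvable.

Set Implicit Arguments.
Unset Strict Implicit.
Unset Printing Implicit Defensive.

(* [next c x] is the successor of [x] in the cyclic word [c], and is [x] itself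
   when [x] does not occur in [c]: the condition says s = (c_0 c_1 ... c_(l-1)). *)
Definition lcycles (l n : nat) : {set 'S_n} :=
  [set s : 'S_n |
     [exists c : l.-tuple 'I_n, uniq c && [forall x : 'I_n, s x == next c x]]].

(* The power is that of subsets of a group: A ^+ k = {a_1 * ... * a_k | a_i \in A}. *)
Definition cycle_power_eq_Alt (k l n : nat) : Prop :=
  (lcycles l n ^+ k = 'Alt_('I_n))%g.

(* n(k,l) = n, given as a relation since the maximum of a set of naturals need
   not exist a priori. *)
Definition is_nkl (k l n : nat) : Prop :=
  cycle_power_eq_Alt k l n /\
  (forall m : nat, cycle_power_eq_Alt k l m -> m <= n).

(* Main.v *)
Require Import Defs.
From mathcomp Require Import all_boot all_fingroup all_solvable zify.

(** Write l = 3m and k = 2k', so that n(k,l) = 4mk' + 1.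

    Lower bound.  Cutting a d-cycle at one of its points writes it as a product
    of an i-cycle and a j-cycle through a common point, for any i + j = d + 1.
    Inserting (x z)(x z) = 1 glues such factorizations of disjoint permutations
    into one, so a permutation with c cycles on n points is a product of two
    cycles of length (n + c) / 2 when n + c is even, and these can be lengthened,
    again by inserting (x z)(x z).  Hence every even permutation of 4m + 1 points
    is a product of two l-cycles.  For larger k', order the cycles of the
    permutation suitably and cut one of them, so as to split off an even
    permutation of 4m + 1 points, or of 4m + 2 points but with few cycles; the
    rest is then an even permutation moving at most 4m(k' - 1) + 1 points.

    Upper bound.  If s is a product of k l-cycles whose supports form p connected
    components, then n + c(s) <= k(l - 1) + 2p.  When s has no fixed point and no
    cycle of length l, every component uses at least two factors, so 2p <= k and
    n + c(s) <= kl.  An even permutation made of 2-cycles and one cycle of length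
    2, 3, 4 or 5 violates this as soon as n > 4mk' + 1. *)

Set Implicit Arguments.
Unset Strict Implicit.
Unset Printing Implicit Defensive.
Local Open Scope group_scope.

Section Cycles.
Variable T : finType.
Implicit Types (x y z : T) (s t u v c : seq T) (cs ds : seq (seq T)) (p q : {perm T}).

Definition cyc c : {perm T} :=
  if c is x :: s then \prod_(y <- s) tperm x y else 1.

Definition cycs cs : {perm T} := \prod_(c <- cs) cyc c.

Lemma cyc_cat x s t : cyc (x :: s ++ t) = cyc (x :: s) * cyc (x :: t).
Proof. by rewrite /= big_cat. Qed.

Lemma cyc_cons2 x y s : cyc [:: x, y & s] = tperm x y * cyc (x :: s).
Proof. by rewrite /= big_cons. Qed.

Lemma cyc_rcons x y s : cyc (x :: rcons s y) = cyc (x :: s) * tperm x y.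
Proof. by rewrite -cats1 cyc_cat /= big_seq1. Qed.

Lemma cyc1 x : cyc [:: x] = 1.
Proof. by rewrite /= big_nil. Qed.

Lemma cycE c : uniq c -> cyc c =1 next c.
Proof.
case: c => [_ z|x s]; first by rewrite perm1.
elim/last_ind: s => [_ z|s w IHs].
  by rewrite cyc1 perm1 /=; case: eqP.
rewrite -rcons_cons rcons_uniq => /andP[w_xs Uxs] z.
rewrite rcons_cons cyc_rcons permM {}IHs //=.
have [->|z_x] := eqVneq z x.
  case: s w_xs Uxs => [|a s] /=; first by rewrite eqxx tpermL.
  rewrite !inE eqxx !negb_or => /and3P[_ wa _] /andP[/andP[xa _] _].
  by rewrite tpermD // eq_sym.
suff H y : y != w -> (x != y) || (z != y) ->
    next_at z x y (rcons s w) = tperm x w (next_at z x y s).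
  by rewrite H ?z_x ?orbT //; move: w_xs; rewrite inE negb_or eq_sym => /andP[].
have [x_s x_w] : x \notin s /\ x != w.
  move: w_xs Uxs; rewrite inE negb_or => /andP[wx _] /andP[? _].
  by split; rewrite // eq_sym.
have w_s : w \notin s by move: w_xs; rewrite inE negb_or => /andP[].
elim: s y x_s w_s {w_xs Uxs} => [|a s IHs] y /=.
  move=> *; case: ifP => _; rewrite ?tpermL //.
  by case: eqP => [->|/eqP zw]; rewrite ?tpermR // tpermD // eq_sym.
rewrite !inE !negb_or => /andP[xa x_s] /andP[wa w_s] yw xzy.
case: ifP => _; first by rewrite tpermD.
by apply: IHs => //; rewrite ?xa // eq_sym.
Qed.

Lemma cyc_out c z : uniq c -> z \notin c -> cyc c z = z.
Proof. by move=> Uc zc; rewrite cycE // next_nth (negPf zc). Qed.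

Lemma mem_cyc c z : uniq c -> (cyc c z \in c) = (z \in c).
Proof. by move=> Uc; rewrite cycE // mem_next. Qed.

Lemma cyc_rot n c : uniq c -> cyc (seq.rot n c) = cyc c.
Proof.
by move=> Uc; apply/permP=> z; rewrite !cycE ?rot_uniq // next_rot.
Qed.

Lemma cyc_head c x : uniq c -> x \in c ->
  exists s, [/\ uniq (x :: s), perm_eq (x :: s) c & cyc (x :: s) = cyc c].
Proof.
move=> Uc /rot_to[i s Es]; exists s; rewrite -Es rot_uniq Uc cyc_rot //.
by rewrite perm_rot.
Qed.

Lemma cycs_cat cs ds : cycs (cs ++ ds) = cycs cs * cycs ds.
Proof. exact: big_cat. Qed.

Lemma cycs_cons c cs : cycs (c :: cs) = cyc c * cycs cs.
Proof. exact: big_cons. Qed.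

Lemma cycs_out cs z : uniq (flatten cs) -> z \notin flatten cs -> cycs cs z = z.
Proof.
elim: cs => [|c cs IHcs] /=; first by rewrite /cycs big_nil perm1.
rewrite cat_uniq mem_cat negb_or => /and3P[Uc _ Ucs] /andP[zc zcs].
by rewrite cycs_cons permM cyc_out // IHcs.
Qed.

Lemma cycs_in cs c z : uniq (flatten cs) -> c \in cs -> z \in c ->
  cycs cs z = next c z.
Proof.
elim: cs => [|d cs IHcs] //=; rewrite cat_uniq => /and3P[Ud /hasPn dcs Ucs].
rewrite cycs_cons permM inE => /predU1P[->|c_cs] zc.
  rewrite cycs_out ?cycE //; apply: contraL (_ : next d z \in d) => [|]; first exact: dcs.
  by rewrite mem_next.
rewrite (cyc_out Ud) ?IHcs //; apply: dcs; apply/flattenP; by exists c.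
Qed.

Lemma cycs_perm cs ds : uniq (flatten cs) -> perm_eq cs ds -> cycs cs = cycs ds.
Proof.
move=> Ucs cs_ds; have fcd := perm_flatten cs_ds.
have Uds : uniq (flatten ds) by rewrite -(perm_uniq fcd).
apply/permP=> z; have [/flattenP[c c_cs zc]|zcs] := boolP (z \in flatten cs).
  by rewrite !(@cycs_in _ c) // -(perm_mem cs_ds).
by rewrite !cycs_out // -(perm_mem fcd).
Qed.

Lemma cyc_commute c d : uniq (c ++ d) -> commute (cyc c) (cyc d).
Proof.
move=> Ucd; have U2 : uniq (flatten [:: c; d]) by rewrite /= cats0.
have := @cycs_perm [:: c; d] [:: d; c] U2.
rewrite !cycs_cons /cycs big_nil !mulg1; apply; apply/permPl; apply: (perm_catC [:: c] [:: d]).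
Qed.

Lemma odd_cyc c : uniq c -> c != [::] -> odd_perm (cyc c) = ~~ odd (size c).
Proof.
case: c => [|x s] //= /andP[+ _] _; rewrite negbK.
elim: s => [|y s IHs]; first by rewrite big_nil odd_perm1.
rewrite inE negb_or big_cons odd_permM odd_tperm => /andP[-> /IHs ->].
by [].
Qed.

Lemma uniq_flatten_all cs : uniq (flatten cs) -> all uniq cs.
Proof. by elim: cs => //= c cs IHcs; rewrite cat_uniq => /and3P[-> _ /IHcs]. Qed.

Lemma odd_cycs cs : all uniq cs -> [::] \notin cs ->
  odd_perm (cycs cs) = odd (size cs + size (flatten cs)).
Proof.
elim: cs => [|c cs IHcs] /=; first by rewrite /cycs big_nil odd_perm1.
rewrite inE negb_or eq_sym => /andP[Uc Ucs] /andP[c0 cs0].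
rewrite cycs_cons odd_permM odd_cyc // IHcs // size_cat.
by rewrite !oddD /=; case: (odd (size c)); case: (odd (size cs)); case: (odd _).
Qed.

Lemma cycs_exists p : exists cs, [/\ uniq (flatten cs), [::] \notin cs & p = cycs cs].
Proof.
suff [cs [? ? ? ?]] : exists cs, [/\ uniq (flatten cs), [::] \notin cs, p = cycs cs
    & {in flatten cs, forall x, p x != x}] by exists cs.
have [n] := ubnP #|[set x | p x != x]|; elim: n p => // n IHn p ltn.
have [p1|] := boolP [forall x, p x == x].
  exists [::]; split=> //; rewrite /cycs big_nil; apply/permP=> x.
  by rewrite perm1; apply/eqP/(forallP p1).
rewrite negb_forall => /existsP[x px].
pose c := fingraph.orbit p x.
have Uc : uniq c by apply: orbit_uniq.
have Cc : fcycle p c by apply: cycle_orbit perm_inj _.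
have xc : x \in c by apply: in_orbit.
have cP z : z \in c -> cyc c z = p z.
  by move=> zc; rewrite cycE //; apply/eqP; rewrite eq_sym; apply: (next_cycle Cc zc).
pose q := (cyc c)^-1 * p.
have qc z : z \in c -> q z = z.
  move=> zc; rewrite permM -{2}(permKV (cyc c) z) cP //.
  by rewrite -(mem_cyc _ Uc) permKV.
have qD z : z \notin c -> q z = p z.
  by move=> zc; rewrite permM -{1}(cyc_out Uc zc) permK.
have sub z : q z != z -> (z \notin c) && (p z != z).
  have [zc|zc] := boolP (z \in c); first by rewrite qc ?eqxx.
  by rewrite qD.
have [|cs [Ucs cs0 qE csq]] := IHn q.
  apply: (@leq_trans #|[set x | p x != x]|); last by rewrite -ltnS.
  apply: proper_card; apply/properP; split.
    by apply/subsetP=> z; rewrite !inE => /sub/andP[].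
  by exists x; rewrite !inE // qc ?eqxx.
exists (c :: cs); split.
- by rewrite /= cat_uniq Uc Ucs andbT; apply/hasPn=> z /csq /sub /andP[].
- by rewrite inE negb_or cs0 andbT; apply: contraTneq xc => <-.
- by rewrite cycs_cons -qE mulgA mulgV mul1g.
move=> z; rewrite /= mem_cat => /orP[zc|/csq/sub/andP[] //].
apply: contra px => /eqP pz.
have : fconnect p z x by rewrite fconnect_sym ?fconnect_orbit //; apply: perm_inj.
by move=> /iter_findex <-; rewrite iter_fix // pz.
Qed.

Lemma cyc_tperm x z u : x \notin u -> z \notin u ->
  cyc (x :: u) * tperm x z = tperm x z * cyc (z :: u).
Proof.
elim: u => [|y u IHu]; first by rewrite !cyc1 mul1g mulg1.
rewrite !inE !negb_or => /andP[xy xu] /andP[zy zu].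
by rewrite !cyc_cons2 -mulgA IHu // !mulgA [tperm x y * _]conjgC tpermJ tpermL tpermD.
Qed.

(* A factorization into an (i+1)-cycle and a (j+1)-cycle inside V; their common
   point x is where two such factorizations get glued in [factors2_mul]. *)
Definition factors2 (i j : nat) p (V : seq T) := exists x u v,
  [/\ size u = i /\ size v = j, uniq (x :: u), uniq (x :: v),
      {subset x :: u ++ v <= V} & p = cyc (x :: u) * cyc (x :: v)].

Lemma factors2_cyc i j c : uniq c -> size c = (i + j).+1 -> factors2 i j (cyc c) c.
Proof.
case: c => [|x s] // Uc [sz]; exists x, (take i s), (drop i s).
have [su sv] : size (take i s) = i /\ size (drop i s) = j.
  by rewrite size_takel ?size_drop; lia.
have Es := cat_take_drop i s; move: (take i s) (drop i s) su sv Es Uc => u v su sv <-.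
rewrite cyc_cat /= mem_cat negb_or cat_uniq => /and4P[/andP[-> ->] -> _ ->].
by split.
Qed.

Lemma factors2_mul i j i' j' p q V W : factors2 i j p V -> factors2 i' j' q W ->
  uniq (V ++ W) -> factors2 (i + i').+1 (j + j').+1 (p * q) (V ++ W).
Proof.
move=> [x [u [v [[<- <-] Ux Vx sV ->]]]] [z [u' [v' [[<- <-] Uz Vz sW ->]]]] Uvw.
have D a b : a \in V -> b \in W -> a != b.
  move=> aV bW; apply: contraTneq Uvw => Eab.
  rewrite cat_uniq; apply/nandP; right; apply/nandP; left; rewrite negbK.
  by apply/hasP; exists b; rewrite // -Eab.
have D' (s t : seq T) : {subset s <= V} -> {subset t <= W} -> ~~ has (mem s) t.
  move=> ss st; apply/hasPn=> b /st bW.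
  by apply/negP=> /ss aV; move: (D _ _ aV bW); rewrite eqxx.
have [sxu sxv] : {subset x :: u <= V} /\ {subset x :: v <= V}.
  by split=> a; rewrite inE => H; apply: sV; rewrite inE mem_cat; case/orP: H => ->; rewrite ?orbT.
have [szu szv] : {subset z :: u' <= W} /\ {subset z :: v' <= W}.
  by split=> a; rewrite inE => H; apply: sW; rewrite inE mem_cat; case/orP: H => ->; rewrite ?orbT.
have [xV zW] : x \in V /\ z \in W by split; [apply: sxu | apply: szu]; rewrite mem_head.
have notV s : {subset s <= V} -> z \notin s.
  by move=> ss; apply/negP=> /ss zV; move: (D _ _ zV zW); rewrite eqxx.
have notW s : {subset s <= W} -> x \notin s.
  by move=> ss; apply/negP=> /ss xW; move: (D _ _ xV xW); rewrite eqxx.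
exists x, (u ++ z :: u'), (v' ++ z :: v).
have Eu : cyc (x :: u ++ z :: u') = cyc (x :: u) * cyc (z :: u') * tperm x z.
  rewrite cyc_cat cyc_cons2 -mulgA tpermC cyc_tperm //; first by case/andP: Uz.
  by have := notW _ szu; rewrite inE negb_or => /andP[].
have Uv : uniq ((x :: v) ++ z :: v') by rewrite cat_uniq Vx Vz D'.
have Pv : perm_eq ((z :: v) ++ x :: v') ((x :: v) ++ z :: v').
  by apply/seq.permP=> a; rewrite /= !count_cat /=; lia.
have Ev : cyc (x :: v' ++ z :: v) = tperm x z * cyc (x :: v) * cyc (z :: v').
  have -> : x :: v' ++ z :: v = seq.rot (size (z :: v)) ((z :: v) ++ x :: v').
    by rewrite rot_size_cat.
  rewrite cyc_rot; last by rewrite (perm_uniq Pv).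
  rewrite cat_cons cyc_cat cyc_cons2 mulgA (tpermC x z) -cyc_tperm //; last by case/andP: Vx.
  by have := notV _ sxv; rewrite inE negb_or => /andP[].
split.
- by rewrite !size_cat /=; split; lia.
- by rewrite -cat_cons cat_uniq Ux Uz D'.
- by rewrite -(perm_uniq (permEl (perm_catC (z :: v) (x :: v')))) (perm_uniq Pv).
- move=> a; rewrite -cat_cons catA -cat_cons mem_cat [a \in V ++ W]mem_cat.
  rewrite !(mem_cat, inE).
  have := sxu a; have := sxv a; have := szu a; have := szv a; rewrite !inE.
  by do !case: (_ == _); do !case: (_ \in _) => //=; move=> *; intuition.
rewrite Eu Ev !mulgA -(mulgA _ (tperm x z) (tperm x z)) tperm2 mulg1.
rewrite -!mulgA; congr (_ * _); rewrite !mulgA; congr (_ * _); apply: cyc_commute.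
by rewrite cat_uniq Vx Uz andbT; apply: D'.
Qed.

Lemma leq_size_flatten cs : [::] \notin cs -> size cs <= size (flatten cs).
Proof.
elim: cs => // d ds IHd; rewrite inE negb_or eq_sym -size_eq0 -lt0n => /andP[d_gt0 /IHd].
by rewrite /= size_cat; rewrite -add1n; apply: leq_add.
Qed.

Lemma factors2_cycs i j cs : cs != [::] -> [::] \notin cs -> uniq (flatten cs) ->
    size cs <= i.+1 -> size cs <= j.+1 ->
    (i + j).+2 = size cs + size (flatten cs) ->
  factors2 i j (cycs cs) (flatten cs).
Proof.
elim: cs i j => // c cs IHcs i j _ /=.
rewrite inE negb_or cat_uniq size_cat eq_sym => /andP[c0 cs0] /and3P[Uc Dcs Ucs] hi hj hW.
have c_gt0 : 0 < size c by rewrite lt0n size_eq0.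
have [E|cs_neq0] := eqVneq cs [::].
  rewrite E cycs_cons /cycs big_nil mulg1 cats0; apply: factors2_cyc => //.
  by move: hW; rewrite E /=; lia.
have cs_gt0 : 0 < size cs by rewrite lt0n size_eq0.
have [a [b [a' [b' [-> -> Ec [le_a le_b] Ecs]]]]] : exists a b a' b',
  [/\ i = (a + a').+1, j = (b + b').+1, size c = (a + b).+1,
      size cs <= a'.+1 /\ size cs <= b'.+1 & (a' + b').+2 = size cs + size (flatten cs)].
  move: (leq_size_flatten cs0) c_gt0 cs_gt0 hi hj hW; clear.
  move: (size c) (size cs) (size (flatten cs)) => d n f *.
  pose a := minn d.-1 (i - n); pose b := d.-1 - a.
  by exists a, b, (i - a.+1), (j - b.+1); rewrite /b /a; split; lia.
rewrite cycs_cons; apply: factors2_mul; last by rewrite cat_uniq Uc Dcs.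
  exact: factors2_cyc.
exact: IHcs.
Qed.

Definition cycle_product (k l : nat) p := exists cs : seq (seq T),
  [/\ size cs = k, all (fun c => uniq c && (size c == l)) cs & p = cycs cs].

Lemma cycle_productM k k' l p q :
  cycle_product k l p -> cycle_product k' l q -> cycle_product (k + k') l (p * q).
Proof.
move=> [cs [<- Hcs ->]] [ds [<- Hds ->]]; exists (cs ++ ds).
by rewrite size_cat all_cat Hcs Hds cycs_cat.
Qed.

Lemma cycle_product2 l p : cycle_product 2 l p <->
  exists u v, [/\ uniq u, uniq v, size u = l, size v = l & p = cyc u * cyc v].
Proof.
split.
  move=> [[|u [|v [|w cs]]]] [] // _ /and3P[/andP[Uu /eqP su] /andP[Uv /eqP sv] _] ->.
  by exists u, v; rewrite !cycs_cons /cycs big_nil mulg1.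
move=> [u [v [Uu Uv su sv ->]]]; exists [:: u; v].
by rewrite /= Uu Uv su sv eqxx !cycs_cons /cycs big_nil mulg1.
Qed.

Lemma cycle_product2S h p : 0 < h < #|T| ->
  cycle_product 2 h p -> cycle_product 2 h.+1 p.
Proof.
move=> /andP[h_gt0 hT] /cycle_product2[u [v [Uu Uv su sv ->]]]; apply/cycle_product2.
have [uv|] := boolP (all (mem v) u).
  have [x xu] : exists x, x \in u.
    by case: (u) su h_gt0 => [<-|x u'] //; exists x; rewrite mem_head.
  have xv : x \in v by apply: (allP uv).
  have [z zu] : exists z, z \notin u.
    apply/existsP; rewrite -negb_forall; apply/negP=> /forallP uT.
    move: hT; rewrite -su -(card_uniqP Uu) ltnNge => /negP; apply.
    by apply/subset_leq_card/subsetP.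
  have zv : z \notin v.
    have /(uniq_min_size Uu) : {subset u <= v} by apply/allP.
    by rewrite su sv => /(_ (leqnn _))[_ <-].
  have [u' [Uu' Pu <-]] := cyc_head Uu xu; have [v' [Uv' Pv <-]] := cyc_head Uv xv.
  exists (x :: rcons u' z), (x :: z :: v').
  rewrite cyc_rcons cyc_cons2 mulgA -[_ * _ * tperm x z]mulgA tperm2 mulg1.
  rewrite -rcons_cons rcons_uniq Uu' (perm_mem Pu) zu size_rcons (perm_size Pu) su.
  have -> : size [:: x, z & v'] = h.+1 by rewrite -sv -(perm_size Pv).
  split=> //; have := zv; rewrite -(perm_mem Pv) inE negb_or => /andP[zx zv'].
  by move: Uv' => /= /andP[xv' ->]; rewrite inE negb_or eq_sym zx xv' zv'.
move=> /allPn[x xu /= xv].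
have [z zv zu] : exists2 z, z \in v & z \notin u.
  apply/allPn; apply: contra xv => vu.
  have /(uniq_min_size Uv) : {subset v <= u} by apply/allP.
  by rewrite su sv => /(_ (leqnn _))[_ ->].
have [u' [Uu' Pu <-]] := cyc_head Uu xu; have [v' [Uv' Pv <-]] := cyc_head Uv zv.
exists (x :: rcons u' z), (z :: x :: v').
rewrite cyc_rcons cyc_cons2 (tpermC z) mulgA -[_ * _ * tperm x z]mulgA tperm2 mulg1.
rewrite -rcons_cons rcons_uniq Uu' (perm_mem Pu) zu size_rcons (perm_size Pu) su.
have -> : size [:: z, x & v'] = h.+1 by rewrite -sv -(perm_size Pv).
split=> //; have := xv; rewrite -(perm_mem Pv) inE negb_or => /andP[xz xv'].
by move: Uv' => /= /andP[zv' ->]; rewrite inE negb_or eq_sym xz xv' zv'.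
Qed.

Lemma cycle_product2_leq h l p : 0 < h <= l -> l <= #|T| ->
  cycle_product 2 h p -> cycle_product 2 l p.
Proof.
move=> /andP[h_gt0 /subnK <-]; elim: (l - h) => [|d IHd] //= lT Hp.
rewrite addSn in lT *; apply: cycle_product2S; last by apply: IHd => //; apply: ltnW.
by rewrite addn_gt0 h_gt0 orbT.
Qed.

Lemma cycs_nontrivial cs : cycs [seq c <- cs | 1 < size c] = cycs cs.
Proof.
rewrite /cycs big_filter big_mkcond; apply: eq_bigr => -[|x [|y s]] _ //=.
by rewrite big_nil.
Qed.

Lemma cycs_product2 l cs : 0 < l <= #|T| -> [::] \notin cs -> uniq (flatten cs) ->
    ~~ odd (size cs + size (flatten cs)) -> size cs + size (flatten cs) <= l.*2 ->
  cycle_product 2 l (cycs cs).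
Proof.
move=> /andP[l_gt0 lT] cs0 Ucs ev bd.
have [->|csn] := eqVneq cs [::].
  have [x _] : exists x : T, true.
    by case: (pickP T) (leq_trans l_gt0 lT) => [x|/eq_card0->] //; exists x.
  apply: (@cycle_product2_leq 1) => //; apply/cycle_product2; exists [:: x], [:: x].
  by rewrite /cycs big_nil !cyc1 mulg1.
have csf := leq_size_flatten cs0.
have cs_gt0 : 0 < size cs by rewrite lt0n size_eq0.
have [h [Eh le_h h_gt0 h_le]] : exists h, [/\ size cs + size (flatten cs) = h.*2,
    size cs <= h, 0 < h & h <= l].
  move: csf cs_gt0 ev bd; move: (size cs) (size (flatten cs)) => n f *.
  by exists (n + f)./2; split; lia.
have [|||x [u [v [[su sv] Uu Uv _ ->]]]] := @factors2_cycs h.-1 h.-1 cs csn cs0 Ucs;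
  rewrite ?prednK //.
  by rewrite Eh; lia.
apply: (@cycle_product2_leq h) => //; first by rewrite h_gt0.
by apply/cycle_product2; exists (x :: u), (x :: v); rewrite /= su sv prednK.
Qed.

End Cycles.

Section Knapsack.
Variable T : eqType.
Implicit Types (c d e : seq T) (cs ds : seq (seq T)).

Lemma size_flatten_geq n cs :
  all (fun c => n <= size c) cs -> n * size cs <= size (flatten cs).
Proof.
elim: cs => [|c cs IHcs] /=; first by rewrite muln0.
by move=> /andP[nc /IHcs]; rewrite size_cat mulnS; apply: leq_add.
Qed.

Lemma size_flatten_leq n cs :
  all (fun c => size c <= n) cs -> size (flatten cs) <= n * size cs.
Proof.
elim: cs => [|c cs IHcs] //= /andP[nc /IHcs].
by rewrite size_cat mulnS; apply: leq_add.
Qed.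

Lemma flatten_prefix n cs : n < size (flatten cs) ->
  exists s1 c s2, [/\ cs = s1 ++ c :: s2, size (flatten s1) <= n
                    & n < size (flatten s1) + size c].
Proof.
elim: cs n => [|c cs IHcs] n //=; rewrite size_cat => hn.
have [nc|cn] := ltnP n (size c); first by exists [::], c, cs.
have [|s1 [d [s2 [-> h1 h2]]]] := IHcs (n - size c); first by lia.
by exists (c :: s1), d, s2; rewrite /= size_cat; split=> //; lia.
Qed.

(* Cutting c after s1 will leave an odd number of cycles on 4m + 1 points, or an
   even number, small enough for [cycs_product2], on 4m + 2 points.  The cycles
   are sorted by decreasing length, and if the greedy prefix s1 does not do, either
   adding the shortest cycle to it, or also replacing its longest cycle by c, does. *)
Lemma knapsack m cs : 1 < m -> 8 * m < size (flatten cs) ->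
    odd (size (flatten cs)) -> [::] \notin cs ->
  exists s1 c s2, [/\ perm_eq cs (s1 ++ c :: s2), size (flatten s1) <= 4 * m &
    if odd (size s1) then
      (size s1).+3 <= 2 * m /\ (4 * m).+2 <= size (flatten s1) + size c
    else 4 * m < size (flatten s1) + size c].
Proof.
move=> m_gt1 Nm oddN cs0.
pose r c d := size d <= size c.
have r_tr : transitive r by move=> c d e /[swap]; apply: leq_trans.
have r_tot : total r by move=> c d; apply: leq_total.
have := sort_sorted r_tot cs; rewrite (sorted_pairwise r_tr).
have := permEl (perm_sort r cs); move: (sort r cs) => ds.
rewrite perm_sym => Pds.
have szds := perm_size (perm_flatten Pds); rewrite szds in Nm oddN.
have [|s1 [c [s2 [Eds le_s1 lt_s1]]]] := @flatten_prefix (4 * m) ds; first by lia.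
have {cs0} : all (fun c => 1 <= size c) ds.
  apply/allP=> a; rewrite -(perm_mem Pds) => acs; rewrite lt0n size_eq0.
  by apply: contraNneq cs0 => <-.
have [ev|od] := boolP (~~ odd (size s1)).
  by exists s1, c, s2; rewrite -Eds (negPf ev).
rewrite negbK in od.
case: s1 Eds le_s1 lt_s1 od => [|d s1] // Eds le_s1 lt_s1 od.
move=> ge1 srt.
have [c_le s1_le le_c] : [/\ {in d :: s1, forall a, size c <= size a},
    {in d :: s1, forall a, size a <= size d} & {in s2, forall a, size a <= size c}].
  move: srt; rewrite Eds pairwise_cat => /and3P[/allrelP H1 /andP[/allP H2 _] /andP[/allP H3 _]].
  split=> a Ha; first by apply: H1; rewrite // mem_head.
    by move: Ha; rewrite inE => /predU1P[->//|]; apply: H2.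
  exact: H3.
case: (lastP s2) Eds le_c => [|{}s2 e] Eds le_c.
  have := c_le d (mem_head _ _); move: Nm; rewrite Eds flatten_cat size_cat /= cats0 !size_cat.
  by move: le_s1; rewrite /= size_cat; lia.
have e_le : {in ds, forall a, size e <= size a}.
  move: srt; rewrite Eds -rcons_cons -rcons_cat -cats1 pairwise_cat => /and3P[/allrelP H1 _ _] a.
  by rewrite mem_cat mem_seq1 => /orP[Ha|/eqP->//]; apply: H1; rewrite // mem_head.
have cd : size c <= size d by apply: c_le; apply: mem_head.
have ec : size e <= size c by apply: e_le; rewrite Eds mem_cat mem_head orbT.
have e_gt0 : 0 < size e.
  by apply: (allP ge1); rewrite Eds mem_cat !inE mem_rcons mem_head !orbT.
have [e_fits|e_big] := leqP (size (flatten (d :: s1)) + size e) (4 * m).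
  exists (d :: s1 ++ [:: e]), c, s2; split.
  - apply: (perm_trans Pds); rewrite Eds; apply/seq.permP=> a.
    by rewrite -cats1 /= !count_cat /= !count_cat /=; clear; lia.
  - by rewrite -cat_cons flatten_cat size_cat /= cats0.
  rewrite -cat_cons size_cat oddD od /= flatten_cat size_cat /= cats0 size_cat.
  by move: lt_s1; rewrite /= size_cat; lia.
move: (le_s1) (lt_s1) (e_big); rewrite /= !size_cat => le_s1' lt_s1' e_big'.
have [ce_fits|ce_big] := leqP (size (flatten s1) + size c + size e) (4 * m).
  exists (s1 ++ [:: c; e]), d, s2; split.
  - apply: (perm_trans Pds); rewrite Eds; apply/seq.permP=> a.
    by rewrite -cats1 /= !count_cat /= !count_cat /=; clear; lia.
  - by rewrite flatten_cat size_cat /= cats0 size_cat addnA.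
  move: od; rewrite size_cat addn2 /= negbK => /negPf ->.
  by rewrite flatten_cat size_cat /= cats0 size_cat; lia.
have geA := @size_flatten_geq (size c) (d :: s1).
have {geA} geA : size c * size (d :: s1) <= size (flatten (d :: s1)).
  by apply: geA; apply/allP.
have leA : size (flatten (d :: s1)) <= size d * size (d :: s1).
  by apply: size_flatten_leq; apply/allP.
move: geA leA od; rewrite /= size_cat => geA leA od.
have [Ec|ge2] : size d + size (flatten s1) + size c = (4 * m).+1 \/
    (4 * m).+2 <= size d + size (flatten s1) + size c by lia.
  have Ecd : size c = size d by lia.
  have [p Ep] : exists p, size s1 = p.*2 by exists (size s1)./2; lia.
  by rewrite Ecd Ep in geA leA Ec; lia.
exists (d :: s1), c, (rcons s2 e); rewrite -Eds /= od size_cat; split=> //; split=> //.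
rewrite leqNgt; apply/negP=> j_big.
have c_le2 : size c <= 2.
  rewrite leqNgt; apply/negP=> c_gt2; have := leq_mul c_gt2 (leqnn (size s1).+1); lia.
have [e1|e2] : size e = 1%N \/ size e = 2 by lia.
  have Ecd : size c = size d by lia.
  have [d1|d2] : size d = 1%N \/ size d = 2 by lia.
    by rewrite Ecd d1 in geA leA le_s1' e_big'; lia.
  by rewrite Ecd d2 in geA leA le_s1' e_big'; lia.
have c2 : size c = 2 by lia.
have szs2 : size (flatten (rcons s2 e)) = (2 * (size s2).+1)%N.
  apply/eqP; rewrite -(size_rcons s2 e) eqn_leq size_flatten_leq ?size_flatten_geq //.
    by apply/allP=> a Ha; rewrite -e2; apply: e_le; rewrite Eds mem_cat !inE Ha !orbT.
  by apply/allP=> a Ha; rewrite -c2; apply: le_c.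
by move: oddN; rewrite Eds flatten_cat size_cat /= !size_cat szs2 c2; lia.
Qed.

End Knapsack.

Section LowerBound.
Variable T : finType.
Implicit Types (c : seq T) (cs ds : seq (seq T)).

Lemma cycs_pad n cs : [::] \notin cs -> uniq (flatten cs) ->
    size (flatten cs) <= n <= #|T| ->
  exists ds, [/\ [::] \notin ds, uniq (flatten ds), size (flatten ds) = n,
    odd (size ds + size (flatten ds)) = odd (size cs + size (flatten cs)) & cycs ds = cycs cs].
Proof.
move=> cs0 Ucs /andP[/subnK <-]; elim: (n - _) => [|d IHd] ltT; first by exists cs.
have [|ds [ds0 Uds Sds Ods <-]] := IHd; first by apply: ltnW.
have [x xds] : exists x, x \notin flatten ds.
  apply/existsP; rewrite -negb_forall; apply/negP=> /forallP dsT.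
  move: ltT; rewrite addSn -Sds -(card_uniqP Uds) ltnNge => /negP; apply.
  by apply/subset_leq_card/subsetP.
exists ([:: x] :: ds); split; rewrite ?cycs_cons ?cyc1 ?mul1g //=.
- by rewrite xds.
- by rewrite Sds.
by rewrite addnS /= negbK.
Qed.

(* The trivial cycles, which would spoil the weight bound of [cycs_product2],
   are first discarded. *)
Lemma cycs_product2_block m cs : (0 < 3 * m <= #|T|)%N -> [::] \notin cs ->
    uniq (flatten cs) -> ~~ odd (size cs + size (flatten cs)) ->
    size (flatten cs) <= (4 * m).+1 \/
      size (flatten cs) <= (4 * m).+2 /\ (size cs).+2 <= 2 * m ->
  cycle_product 2 (3 * m) (cycs cs).
Proof.
move=> mT cs0 Ucs ev bd; rewrite -cycs_nontrivial.
have : [/\ size [seq c <- cs | 1 < size c] <= size cs,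
          size (flatten [seq c <- cs | 1 < size c]) <= size (flatten cs) &
   odd (size [seq c <- cs | 1 < size c] + size (flatten [seq c <- cs | 1 < size c]))
     = odd (size cs + size (flatten cs))].
  elim: (cs) cs0 => // c ds IHd; rewrite inE negb_or eq_sym -size_eq0 -lt0n.
  move=> /andP[c0 /IHd[h1 h2 h3]] /=.
  rewrite !oddD in h3; case: ifP => c1 /=; rewrite ?size_cat; split; try lia.
  have -> : size c = 1%N by apply/eqP; rewrite eqn_leq c0 andbT leqNgt c1.
  by rewrite oddD h3 add1n addnS /= negbK oddD.
set ds := [seq _ <- _ | _] => -[le_n le_f eq_o].
have : all (fun c => 2 <= size c) ds by apply: filter_all.
move=> /size_flatten_geq ge2.
apply: cycs_product2 => //.
- by rewrite mem_filter.
- apply: subseq_uniq Ucs; rewrite /ds; elim: (cs) => //= c es IH.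
  by case: ifP => _ /=; [rewrite cat_subseq | apply: subseq_trans IH (suffix_subseq _ _)].
- by rewrite eq_o.
move: eq_o le_n le_f ge2 bd; rewrite (negPf ev); clear.
move: (size ds) (size (flatten ds)) (size cs) (size (flatten cs)) => n f n' f'; lia.
Qed.

Lemma cycs_cycle_product m k cs : 1 < m -> 0 < k -> (4 * m * k).+1 <= #|T| ->
    [::] \notin cs -> uniq (flatten cs) -> size (flatten cs) <= (4 * m * k).+1 ->
    ~~ odd (size cs + size (flatten cs)) ->
  cycle_product (2 * k) (3 * m) (cycs cs).
Proof.
move=> m_gt1; elim: k cs => // k IHk cs _ leT cs0 Ucs le_cs ev.
have mT : (0 < 3 * m <= #|T|)%N by lia.
have [k0|k_gt0] := posnP k.
  by rewrite k0 muln1 in le_cs *; apply: cycs_product2_block => //; left.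
have [|ds [ds0 Uds Sds]] := @cycs_pad (4 * m * k.+1).+1 cs cs0 Ucs; first by rewrite le_cs.
rewrite (negPf ev) => Ods <-.
have /= := @knapsack T m ds m_gt1; rewrite Sds => /(_ _ _ ds0)[||s1 [c [s2 [Pds le_s1 alt]]]].
- by move: (leq_pmulr m k_gt0); rewrite mulnS; lia.
- by lia.
have /= Pfl := perm_flatten Pds.
rewrite (cycs_perm Uds Pds).
have cs0' : [::] \notin s1 ++ c :: s2 by rewrite -(perm_mem Pds).
have U : uniq (flatten (s1 ++ c :: s2)) by rewrite -(perm_uniq Pfl).
have S : size (flatten (s1 ++ c :: s2)) = (4 * m * k.+1).+1 by rewrite -(perm_size Pfl).
rewrite Sds (perm_size Pds) size_cat [size (c :: s2)]/= in Ods.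
rewrite flatten_cat -[flatten (c :: s2)]/(c ++ flatten s2) in U S.
rewrite !size_cat in S.
rewrite mem_cat in_cons !negb_or in cs0'; have /and3P[s10 c0 s20] := cs0'.
case: c c0 alt U S {Pds Pfl cs0'} => [//|x s] _ alt U S.
pose M := if odd (size s1) then (4 * m).+2 else (4 * m).+1.
have [u [v [Es su]]] : exists u v, s = u ++ v /\ size (flatten s1) + (size u).+1 = M.
  pose t := M - (size (flatten s1)).+1.
  exists (take t s), (drop t s); rewrite cat_take_drop; split=> //; rewrite size_takel.
    by move: le_s1; rewrite /t /M; clear; case: odd => /=; lia.
  by move: alt; rewrite /t /M /=; clear; case: odd => /= alt; lia.
have sv : size v + size (flatten s2) = (4 * m * k.+1).+1 - M.
  by move: S su; rewrite Es /= size_cat; clear; lia.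
rewrite Es in U *.
have -> : cycs (s1 ++ (x :: u ++ v) :: s2) = cycs (rcons s1 (x :: u)) * cycs ((x :: v) :: s2).
  by rewrite -cats1 !cycs_cat !cycs_cons cyc_cat /cycs big_nil mulg1 !mulgA.
rewrite mulnS; apply: cycle_productM.
  have su' : size (flatten (rcons s1 (x :: u))) = M.
    by rewrite -cats1 flatten_cat size_cat /= cats0.
  apply: cycs_product2_block => //; rewrite ?su' ?size_rcons.
  - by rewrite mem_rcons in_cons.
  - apply: subseq_uniq U; rewrite -cats1 flatten_cat /= cats0 cat_subseq //= eqxx -catA.
    exact: prefix_subseq.
  - by rewrite addSn /= negbK oddD /M; clear; case: (odd _) => /=; lia.
  by move: alt; rewrite /M; clear; case: odd => alt; lia.
have sv' : size (flatten ((x :: v) :: s2)) = (4 * m * k.+1).+2 - M.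
  rewrite /= size_cat sv [RHS]subSn // /M mulnS.
  by move: m_gt1 (leq_pmulr m k_gt0); clear; case: odd; lia.
apply: IHk => //; rewrite ?sv'.
- by rewrite mulnS in leT; lia.
- apply: subseq_uniq U; rewrite /= -catA -cat1s.
  apply: subseq_trans (suffix_subseq (flatten s1) _); rewrite /= eqxx.
  exact: suffix_subseq.
- by rewrite /M mulnS; clear; case: odd; lia.
move: Ods (leq_pmulr m (ltn0Sn k)); rewrite /M -mulnA [size (_ :: _)]/=; clear.
by move: (size s1) (size s2) (m * k.+1)%N => a b q; case: ifP; lia.
Qed.

End LowerBound.

Section UpperBound.
Variable T : finType.
Implicit Types (x y z : T) (c : seq T) (cs ds : seq (seq T)) (p : {perm T}) (ts : seq (T * T)).

Definition tperms ts : {perm T} := \prod_(t <- ts) tperm t.1 t.2.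

Definition cyc_pairs c := if c is x :: s then [seq (x, y) | y <- s] else [::].

Lemma tperms_cycs cs : tperms (flatten (map cyc_pairs cs)) = cycs cs.
Proof.
rewrite /tperms big_flatten big_map; apply: eq_bigr => -[|x s] _ /=; first by rewrite big_nil.
by rewrite big_map.
Qed.

Lemma size_cyc_pairs cs : [::] \notin cs ->
  size (flatten (map cyc_pairs cs)) + size cs = size (flatten cs).
Proof.
rewrite !size_flatten; elim: cs => [|[|x s] cs IHcs] //=.
by rewrite in_cons /= => /IHcs <-; rewrite size_map; lia.
Qed.

Lemma porbits_tperms ts : #|T| <= #|porbits (tperms ts)| + size ts.
Proof.
rewrite /tperms; elim: ts => [|t ts IHts] /=.
  rewrite big_nil addn0 /porbits card_imset // => x y.
  move=> Exy; have : x \in porbit 1 y by rewrite -Exy porbit_id.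
  by case/porbitP=> i ->; rewrite expg1n perm1.
rewrite big_cons; move: IHts; set p := \prod_(_ <- _) _.
have /= := porbits_mul_tperm p t.1 t.2.
by case: eqP => [->|_]; [rewrite porbit_id tperm1 mul1g | case: (_ \in _)]; lia.
Qed.

(* Ree's inequality for a possibly intransitive group: composing with (x y)
   merges two cycles if the labels of x and y differ, which are then identified,
   and creates at most one new cycle otherwise. *)
Lemma tperms_labels ts : exists f : T -> T,
  (forall t, t \in ts -> f t.1 = f t.2) /\
  #|T| + #|porbits (tperms ts)| <= size ts + (#|f @: T|).*2.
Proof.
elim: ts => [|t ts [f [ft le_f]]].
  exists id; split=> //; rewrite (card_imset _ (@inj_id T)) -addnn add0n leq_add2l.
  exact: leq_imset_card.
rewrite /tperms big_cons -/(tperms ts).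
have /= := porbits_mul_tperm (tperms ts) t.1 t.2.
have [Ef|Nf] := eqVneq (f t.1) (f t.2).
  move=> Eo; exists f; split; first by move=> u; rewrite inE => /predU1P[->|/ft].
  move: Eo le_f; rewrite /=; case: (_ \notin _); case: (_ != _); rewrite /=; lia.
have f_inv z : f (tperms ts z) = f z.
  rewrite /tperms; elim: (ts) ft z => [|u us IHu] ft z; first by rewrite big_nil perm1.
  rewrite big_cons permM IHu; last by move=> v vus; apply: ft; rewrite inE vus orbT.
  by case: tpermP => [->|->|] //; rewrite (ft u) ?mem_head.
have -> /= : t.1 \notin porbit (tperms ts) t.2.
  apply/negP=> /porbitP[i E]; case/eqP: Nf; rewrite E.
  elim: i {E} => [|i IHi]; first by rewrite perm1.
  by rewrite expgSr permM f_inv.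
have -> /= : t.1 != t.2 by apply: contraNneq Nf => ->.
move=> Eo; pose g z := if f z == f t.1 then f t.2 else f z.
exists g; split.
  move=> u; rewrite inE /g => /predU1P[->|/ft ->] //.
  by rewrite eqxx eq_sym (negPf Nf).
have : #|f @: T| <= #|f t.1 |: g @: T|.
  apply/subset_leq_card/subsetP=> _ /imsetP[z _ ->]; rewrite in_setU1.
  have [//|Nz] := eqVneq (f z) (f t.1); apply/imsetP; exists z => //.
  by rewrite /g (negPf Nz).
have arith n o o' s a b (e : bool) :
  n + o <= s + a.*2 -> o' + 2 = (o + 1)%N -> a <= e + b -> n + o' <= s.+1 + b.*2 by lia.
by rewrite cardsU1; apply: arith le_f Eo.
Qed.

Lemma cycs_labels k l cs : size cs = k -> all (fun c => uniq c && (size c == l.+1)) cs ->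
  exists f : T -> T, {in cs, forall c, {in c &, forall x y, f x = f y}} /\
    #|T| + #|porbits (cycs cs)| <= k * l + (#|f @: T|).*2.
Proof.
move=> <- Hcs; have [f [ft le_f]] := tperms_labels (flatten (map cyc_pairs cs)).
exists f; split.
  move=> [|x s] // c_cs.
  have fx y : y \in x :: s -> f y = f x.
    rewrite inE => /predU1P[->//|ys]; apply/esym/(ft (x, y)); apply/flattenP.
    by exists (cyc_pairs (x :: s)); [apply: map_f | apply: map_f].
  by move=> y z /fx -> /fx ->.
suff <- : size (flatten (map cyc_pairs cs)) = (size cs * l)%N by rewrite -tperms_cycs.
rewrite size_flatten; elim: cs Hcs {ft le_f} => [|[|x s] cs IHcs] //=.
by case/andP=> /andP[_ /eqP[sz]] /IHcs ->; rewrite size_map sz mulSn.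
Qed.

Lemma order_eq_next p c x : uniq c -> x \in c -> {in c, p =1 next c} ->
  fingraph.order p x = size c.
Proof.
move=> Uc xc pc; apply: (order_cycle _ Uc xc).
suff -> : fcycle p c = fcycle (next c) c by apply: cycle_next.
have all_c : all (mem c) c by apply/allP.
by apply: (eq_in_cycle _ all_c) => y z yc _ /=; rewrite (pc _ yc).
Qed.

Lemma order_cycs cs c x : uniq (flatten cs) -> c \in cs -> x \in c ->
  fingraph.order (cycs cs) x = size c.
Proof.
move=> Ucs c_cs xc; have Uc := allP (uniq_flatten_all Ucs) _ c_cs.
by apply: order_eq_next => // z; apply: cycs_in.
Qed.

Lemma iter_order_neq (f : T -> T) i x : 0 < i < fingraph.order f x -> iter i f x <> x.
Proof.
by move=> /andP[i0 io] E; have := findex_iter io; rewrite E findex0 => Ei; rewrite -Ei in i0.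
Qed.

Lemma sum_count_mem (A : {set T}) (s : seq T) : \sum_(v in A) count_mem v s <= size s.
Proof.
elim: s => [|a s IHs]; first by rewrite big1.
rewrite /= big_split /= -add1n leq_add //.
have [aA|aA] := boolP (a \in A).
  by rewrite (bigD1 a) //= eqxx big1 // => v /andP[_ /negPf]; rewrite eq_sym => ->.
by rewrite big1 // => v vA; case: eqP => // E; rewrite E vA in aA.
Qed.

Lemma cycs_fix cs z : all uniq cs -> (forall c, c \in cs -> z \notin c) -> cycs cs z = z.
Proof.
elim: cs => [|c cs IHcs] /=; first by rewrite /cycs big_nil perm1.
move=> /andP[Uc Ucs] zcs; rewrite cycs_cons permM cyc_out ?zcs ?mem_head //.
by apply: IHcs => // d dcs; apply: zcs; rewrite inE dcs orbT.
Qed.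

(* A label carried by a single factor c would make c a cycle of the product. *)
Lemma labels_leq l cs (f : T -> T) : all (fun c => uniq c && (size c == l)) cs ->
    {in cs, forall c, {in c &, forall x y, f x = f y}} ->
    (forall x, 1 < fingraph.order (cycs cs) x < l) ->
  (#|f @: T|).*2 <= size cs.
Proof.
move=> Hcs fcs ord.
have [x0 _|T0] := pickP T; last first.
  suff -> : #|f @: T| = 0 by [].
  by apply/eqP; rewrite -leqn0 (leq_trans (leq_imset_card f T)) ?eq_card0.
pose g c := f (head x0 c).
have Ucs : all uniq cs by apply: sub_all Hcs => c /andP[].
have gE c z : c \in cs -> z \in c -> g c = f z.
  move=> c_cs zc; apply: fcs (c_cs) _ _ _ (zc).
  by case: (c) zc => // a s _; apply: mem_head.
apply: leq_trans (_ : size (map g cs) <= _); last by rewrite size_map.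
apply: leq_trans (sum_count_mem (f @: T) _); rewrite -mul2n mulnC -sum_nat_const.
apply: leq_sum => _ /imsetP[x _ ->].
have [c c_cs xc] : exists2 c, c \in cs & x \in c.
  apply/hasP; apply: contraT => /hasPn xcs.
  have := ord x => /andP[o1 _]; case: (@iter_order_neq (cycs cs) 1 x); rewrite ?o1 //=.
  exact: cycs_fix.
case/splitPr: c_cs Hcs Ucs fcs ord gE => cs1 cs2 Hcs Ucs fcs ord gE.
rewrite map_cat count_cat /= (gE c x) ?mem_cat ?mem_head ?orbT // eqxx addnCA ltnS.
rewrite -count_cat -map_cat -has_count; apply: contraT => /hasPn no_f.
have c_cs : c \in cs1 ++ c :: cs2 by rewrite mem_cat mem_head orbT.
have /andP[Uc /eqP szc] := allP Hcs _ c_cs.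
have out z d : f z = f x -> d \in cs1 ++ cs2 -> z \notin d.
  move=> fz d_cs; apply/negP=> zd.
  have dcs : d \in cs1 ++ c :: cs2.
    by move: d_cs; rewrite !mem_cat inE => /orP[->|->]; rewrite ?orbT.
  have /= := no_f (g d) (map_f g d_cs).
  by rewrite (gE d z) // fz eqxx.
have [U1 U2] : all uniq cs1 /\ all uniq cs2 by move: Ucs; rewrite all_cat /= => /and3P[].
have step z : z \in c -> cycs (cs1 ++ c :: cs2) z = cyc c z.
  move=> zc; have fz : f z = f x by apply: (fcs c).
  have z1 : cycs cs1 z = z by apply: cycs_fix => // d d1; apply: out; rewrite ?mem_cat ?d1.
  rewrite cycs_cat cycs_cons !permM z1 cycs_fix // => d d2.
  by apply: out; rewrite ?mem_cat ?d2 ?orbT //; apply: (fcs c); rewrite // mem_cyc.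
have : fingraph.order (cycs (cs1 ++ c :: cs2)) x = size c.
  by apply: order_eq_next => // z zc; rewrite step // cycE.
by move=> E; move: (ord x); rewrite E szc ltnn andbF.
Qed.

End UpperBound.

Lemma lcyclesP l n (s : 'S_n) :
  reflect (exists c, [/\ uniq c, size c = l & s = cyc c]) (s \in lcycles l n).
Proof.
rewrite inE; apply: (iffP existsP) => [[c /andP[Uc /forallP sc]]|[c [Uc sz ->]]].
  exists c; rewrite size_tuple; split=> //; apply/permP=> x.
  by rewrite cycE //; apply/eqP.
exists (tcast sz (in_tuple c)); rewrite val_tcast Uc.
by apply/forallP=> x; rewrite cycE.
Qed.

Lemma lcycles_powP l n k (s : 'S_n) :
  s \in lcycles l n ^+ k <-> cycle_product k l s.
Proof.
elim: k s => [|k IHk] s.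
  rewrite expg0 inE; split=> [/eqP->|[cs [/size0nil -> _ ->]]]; last by rewrite /cycs big_nil.
  by exists [::]; rewrite /cycs big_nil.
rewrite expgS; split.
  case/mulsgP=> p q /lcyclesP[c [Uc sz ->]] /IHk[cs [<- Hcs ->]] ->.
  by exists (c :: cs); rewrite /= Uc sz eqxx cycs_cons.
case=> [[|c cs]] [] // [szk] /= /andP[/andP[Uc /eqP sz] Hcs] ->; rewrite cycs_cons.
apply/mulsgP; exists (cyc c) (cycs cs) => //; first by apply/lcyclesP; exists c.
by apply/IHk; exists cs.
Qed.

Lemma cycle_product_even (T : finType) k l (p : {perm T}) : 0 < l -> ~~ odd k ->
  cycle_product k l p -> ~~ odd_perm p.
Proof.
move=> l_gt0 k_even [cs [szk Hcs ->]].
rewrite odd_cycs; first 1 last.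
- by apply: sub_all Hcs => c /andP[].
- by apply/negP=> /(allP Hcs) /= /eqP E; rewrite -E in l_gt0.
suff -> : size (flatten cs) = (k * l)%N by rewrite szk -mulnS oddM (negPf k_even).
rewrite -szk size_flatten; elim: cs Hcs {szk} => //= c cs IHcs /andP[/andP[_ /eqP->] /IHcs ->].
by rewrite mulSn.
Qed.

Lemma cycle_powers_cover k m : 1 < m -> 0 < k ->
  cycle_power_eq_Alt (2 * k) (3 * m) (4 * m * k).+1.
Proof.
move=> m_gt1 k_gt0; apply/setP=> s; rewrite Alt_even; apply/idP/idP.
  by move/lcycles_powP; apply: cycle_product_even; rewrite ?oddM //; lia.
have [cs [Ucs cs0 ->]] := cycs_exists s => ev; apply/lcycles_powP.
have le_cs : size (flatten cs) <= (4 * m * k).+1.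
  by have := max_card (mem (flatten cs)); rewrite card_ord (card_uniqP Ucs).
apply: cycs_cycle_product; rewrite ?card_ord // -odd_cycs //.
exact: uniq_flatten_all.
Qed.

Lemma not_cycle_product (T : finType) k l q r : 5 < l -> 1 < r <= 5 ->
    #|T| = (r + 2 * q)%N -> k * l < #|T| + q.+1 -> ~~ odd (r + q.+1) ->
  exists p : {perm T}, ~~ odd_perm p /\ ~ cycle_product k l p.
Proof.
move=> l_gt5 r_bd cardT lt_kl ev.
pose sh := r :: nseq q 2.
have sum_sh : sumn sh = #|T| by rewrite /= sumn_nseq cardT.
pose bs := reshape sh (enum T).
have Ebs : flatten bs = enum T by rewrite reshapeKr // -cardE sum_sh.
have Sbs : shape bs = sh by rewrite reshapeKl // -cardE sum_sh.
have Ubs : uniq (flatten bs) by rewrite Ebs enum_uniq.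
have szbs : size bs = q.+1 by rewrite -(size_map size) -/(shape bs) Sbs /= size_nseq.
have szb b : b \in bs -> 1 < size b <= 5.
  move/(map_f size); rewrite -/(shape bs) Sbs inE => /predU1P[->//|].
  by rewrite mem_nseq => /andP[_ /eqP->].
have bs0 : [::] \notin bs by apply/negP=> /szb.
exists (cycs bs); split.
  rewrite odd_cycs // ?szbs ?Ebs -?cardE ?cardT.
    by move: ev; rewrite mul2n !oddD odd_double; lia.
  exact: uniq_flatten_all.
move=> [cs [szk Hcs E]].
have [l' El] : exists l', l = l'.+1 by exists l.-1; lia.
rewrite El in Hcs lt_kl l_gt5.
have [f [fcs le_f]] := cycs_labels szk Hcs.
have le_labels : (#|f @: T|).*2 <= size cs.
  apply: (labels_leq Hcs fcs) => x; rewrite -E.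
  have /flattenP[b b_bs xb] : x \in flatten bs by rewrite Ebs mem_enum.
  by rewrite (order_cycs Ubs b_bs xb); have /andP[-> /=] := szb b b_bs; lia.
have := porbits_tperms (flatten (map (@cyc_pairs T) bs)).
rewrite tperms_cycs; have := size_cyc_pairs bs0; rewrite Ebs -cardE szbs.
move: le_f; rewrite -E; move: le_labels lt_kl; rewrite szk mulnS; clear.
move: #|_ @: _| #|porbits _| #|T| (size _) (k * l')%N => a b n t kl; lia.
Qed.

Lemma cycle_powers_bound k m n : 1 < m -> 0 < k ->
  cycle_power_eq_Alt (2 * k) (3 * m) n -> n <= (4 * m * k).+1.
Proof.
move=> m_gt1 k_gt0 Ealt; rewrite leqNgt; apply/negP=> lt_n.
have mk_gt0 : 0 < m * k by rewrite muln_gt0 k_gt0 andbT ltnW.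
have [r [q [Hr En Hq ev]]] : exists r q, [/\ 1 < r <= 5, n = (r + 2 * q)%N,
    6 * (m * k) < n + q.+1 & ~~ odd (r + q.+1)].
  have [a [b [En b4]]] : exists a b, n = (4 * a + b)%N /\ b < 4.
    by exists (n %/ 4), (n %% 4); rewrite mulnC -divn_eq ltn_pmod.
  have [b0|[b1|[b2|b3]]] : b = 0 \/ b = 1%N \/ b = 2 \/ b = 3 by lia.
  - exists 2, (2 * a).-1; split=> //; lia.
  - exists 5, (2 * a).-2; split=> //; lia.
  - exists 4, (2 * a).-1; split=> //; lia.
  by exists 3, (2 * a)%N; split=> //; lia.
have [] := @not_cycle_product 'I_n (2 * k) (3 * m) q r; rewrite ?card_ord //; first by lia.
  by lia.
move=> p [p_even]; apply; apply/lcycles_powP; move: p_even; rewrite -Alt_even.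
by rewrite -Ealt.
Qed.

Local Close Scope group_scope.

Theorem theoremB (k l : nat) (hk : 2 <= k) (hl : 3 < l)
  (hkeven : ~~ odd k) (hl3 : 3 %| l) :
  is_nkl k l ((2 * k * l) %/ 3 + 1).
Proof.
have [m El] : exists m, l = (3 * m)%N by exists (l %/ 3); rewrite mulnC divnK.
have [k' Ek] : exists k', k = (2 * k')%N by exists k./2; lia.
have -> : (2 * k * l) %/ 3 + 1 = (4 * m * k').+1.
  by rewrite addn1 El mulnCA mulKn // Ek; lia.
rewrite Ek El; split; first by apply: cycle_powers_cover; lia.
by move=> n; apply: cycle_powers_bound; lia.
Qed.
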